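(* The (finite) Hilbert calculus $\mathcal{CR}$ axiomatizes the logic $\mathcal{L}_{\mathsf{CR}}$; that is, for every set of formulas $\Gamma\cup\{\varphi\}\subseteq Fm$ in the language of commutative rings, $\Gamma\vdash_{\mathcal{CR}}\varphi$ if and only if $\Gamma\vdash_{\mathcal{L}_{\mathsf{CR}}}\varphi$.
   Context: The language of commutative rings is $\langle +,\cdot,-,0,1\rangle$ of type $\langle 2,2,1,0,0\rangle$ ($-$ is unary). $\mathsf{CR}$ is the variety of commutative rings (with unity) in this language: $\langle A,+,-,0\rangle$ is an Abelian group, $\langle A,\cdot,1\rangle$ is a commutative monoid, and $a\cdot(b+c)=(a\cdot b)+(a\cdot c)$. $Fm$ is the set of formulas (terms) of this language over a countably infinite set of variables, and $\boldsymbol{Fm}$ the absolutely free algebra of formulas; substitutions are endomorphisms of $\boldsymbol{Fm}$. $\mathcal{L}_{\mathsf{CR}}$ is the logic determined by all matrices $\langle\boldsymbol{A},F\rangle$ with $\boldsymbol{A}\in\mathsf{CR}$ and $F\subseteq A$ an arbitrary subset: $\Gamma\vdash_{\mathcal{L}_{\mathsf{CR}}}\varphi$ iff for every $\boldsymbol{A}\in\mathsf{CR}$, every $F\subseteq A$ and every homomorphism $h\colon\boldsymbol{Fm}\to\boldsymbol{A}$, $h[\Gamma]\subseteq F$ implies $h(\varphi)\in F$. For a Hilbert calculus (a set of rules $\Gamma\vdash\varphi$ with $\Gamma\cup\{\varphi\}$ finite), the logic it determines is: $\Gamma\vdash\varphi$ iff there is a finite proof of $\varphi$ from $\Gamma$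 using substitution instances of the rules. The expression $\alpha\dashv\vdash\beta$ abbreviates the two rules $\alpha\vdash\beta$ and $\beta\vdash\alpha$. $\mathcal{CR}$ is the following Hilbert calculus (and also the logic it determines), where $x,y,z,u,w$ are distinct variables: (A) $w+(u\cdot((x\cdot y)\cdot z))\dashv\vdash w+(u\cdot(x\cdot(y\cdot z)))$ (B) $w+(u\cdot(x\cdot y))\dashv\vdash w+(u\cdot(y\cdot x))$ (C) $w+(u\cdot(x\cdot 1))\dashv\vdash w+(u\cdot x)$ (D) $w+(u\cdot((x+y)+z))\dashv\vdash w+(u\cdot(x+(y+z)))$ (E) $w+(u\cdot(x+y))\dashv\vdash w+(u\cdot(y+x))$ (F) $w+(u\cdot(x+0))\dashv\vdash w+(u\cdot x)$ (G) $w+(u\cdot(x+(-x)))\dashv\vdash w+(u\cdot 0)$ (H) $w+(u\cdot(x\cdot(y+z)))\dashv\vdash w+(u\cdot((x\cdot y)+(x\cdot z)))$ (I) $w+(u\cdot(-(x+y)))\dashv\vdash w+(u\cdot((-x)+(-y)))$ (L) $w+(u\cdot(-(x\cdot y)))\dashv\vdash w+(u\cdot((-x)\cdot y))$ (M) $w+(u\cdot(-(x\cdot y)))\dashv\vdash w+(u\cdot(x\cdot(-y)))$ (N) $0+x\dashv\vdash x$ (O) $x+(1\cdot y)\dashv\vdash x+y$ *)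

(* Defs.v *)
From HB Require Import structures.
From mathcomp Require Import all_boot all_algebra.
From mathcomp Require Import boolp classical_sets.

Set Implicit Arguments.
Unset Strict Implicit.
Unset Printing Implicit Defensive.

Import GRing.Theory.

Record algebra := Algebra {
  carrier :> Type;
  aadd : carrier -> carrier -> carrier;
  amul : carrier -> carrier -> carrier;
  aopp : carrier -> carrier;
  azero : carrier;
  aone : carrier }.

Definition is_hom (A B : algebra) (h : A -> B) : Prop :=
  [/\ forall a b, h (aadd a b) = aadd (h a) (h b),
      forall a b, h (amul a b) = amul (h a) (h b),
      forall a, h (aopp a) = aopp (h a),
      h (azero A) = azero B &
      h (aone A) = aone B].

Inductive formula :=
| Var of nat
| Add of formula & formula
| Mul of formula & formula
| Opp of formula
| Zero
| One.

Lemma formula_comparable : comparable formula.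
Proof. rewrite /comparable /decidable; decide equality; exact: eq_comparable. Defined.

HB.instance Definition _ := hasDecEq.Build formula (compareP formula_comparable).

Definition Fm : algebra := Algebra Add Mul Opp Zero One.

(* [comPzRingType] does not require 0 != 1, so the trivial ring belongs to the
   variety.  The choice structure it carries is no restriction, as it exists on
   every type by the axioms of [boolp]. *)
Definition ring_algebra (A : comPzRingType) : algebra :=
  @Algebra A +%R *%R (@GRing.opp A) 0%R 1%R.

Local Open Scope classical_set_scope.

Definition logic_CR (Gamma : set formula) (phi : formula) : Prop :=
  forall (A : comPzRingType) (F : set A) (h : Fm -> ring_algebra A),
    is_hom h -> h @` Gamma `<=` F -> F (h phi).

(* Premises and conclusion. *)
Definition rule : Type := seq formula * formula.

Definition is_substitution (s : formula -> formula) : Prop :=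
  @is_hom Fm Fm s.

Definition is_proof (H : set rule) (Gamma : set formula) (p : seq formula) :=
  forall p1 psi p2, p = p1 ++ psi :: p2 ->
    Gamma psi \/
    exists (r : rule) (s : formula -> formula),
      [/\ H r, is_substitution s, psi = s r.2 &
          forall chi, chi \in r.1 -> s chi \in p1].

Definition derivable (H : set rule) (Gamma : set formula) (phi : formula) :=
  exists p : seq formula, is_proof H Gamma (rcons p phi).

Definition birule (a b : formula) : seq rule :=
  [:: ([:: a], b); ([:: b], a)].

Declare Scope fm_scope.
Delimit Scope fm_scope with Fm.
Bind Scope fm_scope with formula.
Notation "a + b" := (Add a b) : fm_scope.
Notation "a * b" := (Mul a b) : fm_scope.
Notation "- a" := (Opp a) : fm_scope.
Notation "0" := Zero : fm_scope.
Notation "1" := One : fm_scope.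
Notation "a -||- b" := (birule a b) (at level 70, no associativity) : fm_scope.

Definition calculus_CR : seq rule :=
  let x := Var 0%N in let y := Var 1%N in let z := Var 2%N in
  let u := Var 3%N in let w := Var 4%N in
  flatten [::
    w + (u * ((x * y) * z)) -||- w + (u * (x * (y * z)));
    w + (u * (x * y)) -||- w + (u * (y * x));
    w + (u * (x * 1)) -||- w + (u * x);
    w + (u * ((x + y) + z)) -||- w + (u * (x + (y + z)));
    w + (u * (x + y)) -||- w + (u * (y + x));
    w + (u * (x + 0)) -||- w + (u * x);
    w + (u * (x + (- x))) -||- w + (u * 0);
    w + (u * (x * (y + z))) -||- w + (u * ((x * y) + (x * z)));
    w + (u * (- (x + y))) -||- w + (u * ((- x) + (- y)));
    w + (u * (- (x * y))) -||- w + (u * ((- x) * y));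
    w + (u * (- (x * y))) -||- w + (u * (x * (- y)));
    0 + x -||- x;
    x + (1 * y) -||- x + y
  ]%Fm.

(* Main.v *)
(** Call [a] and [b] indiscernible when [w + u * a] and [w + u * b] are
    interderivable for all [w] and [u].  The contexts [w + u * _] are closed
    under composition with the ring operations up to interderivability, so
    indiscernibility is a congruence; its quotient of [Fm] is a commutative
    ring, by rules (A)-(H).  Taking for [F] the image of [Gamma] in this ring,
    [logic_CR Gamma phi] makes [phi] indiscernible from some member of
    [Gamma], from which it is derivable by (N) and (O). *)
From HB Require Import structures.
Require Import Defs.
From mathcomp Require Import all_boot all_algebra.
From mathcomp Require Import boolp classical_sets.

Set Implicit Arguments.
Unset Strict Implicit.
Unset Printing Implicit Defensive.

Import GRing.Theory.

Local Open Scope classical_set_scope.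

(** * Evaluation and homomorphisms *)

Fixpoint eval (A : algebra) (v : nat -> A) (a : formula) : A :=
  match a with
  | Var n => v n
  | Add a b => aadd (eval v a) (eval v b)
  | Mul a b => amul (eval v a) (eval v b)
  | Opp a => aopp (eval v a)
  | Zero => azero A
  | One => aone A
  end.

Lemma eval_is_hom (A : algebra) (v : nat -> A) : @is_hom Fm A (eval v).
Proof. by []. Qed.

Lemma is_hom_comp (A B C : algebra) (g : B -> C) (f : A -> B) :
  is_hom g -> is_hom f -> is_hom (g \o f).
Proof.
move=> [gD gM gN g0 g1] [fD fM fN f0 f1].
by split=> [a b|a b|a||] /=; rewrite ?fD ?fM ?fN ?f0 ?f1.
Qed.

(** * Proofs in an arbitrary Hilbert calculus *)

Section HilbertCalculus.
Variables (H : set rule) (Gamma : set formula).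

(** Trades the quantification over all splittings in [is_proof] for a recursion on the last line,
    which allows induction along a proof. *)
Lemma is_proof_rcons p psi : is_proof H Gamma (rcons p psi) <->
  is_proof H Gamma p /\
  (Gamma psi \/ exists (r : rule) (s : formula -> formula),
    [/\ H r, is_substitution s, psi = s r.2 &
        forall chi, chi \in r.1 -> s chi \in p]).
Proof.
split=> [prf|[prf step] p1 chi p2].
  split; last by apply: (prf p psi [::]); rewrite cats1.
  by move=> p1 chi p2 def_p; apply: (prf p1 chi (rcons p2 psi));
    rewrite def_p rcons_cat.
case/lastP: p2 => [|p2 c]; first by rewrite cats1 => /rcons_inj[<- <-].
by rewrite -rcons_cons -rcons_cat => /rcons_inj[/prf].
Qed.

Lemma derivable_hyp phi : Gamma phi -> derivable H Gamma phi.
Proof.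
by move=> Gphi; exists [::]; apply/is_proof_rcons; split=> [[]//|]; left.
Qed.

Lemma derivable_rule1 a b s : H ([:: a], b) -> is_substitution s ->
  derivable H Gamma (s a) -> derivable H Gamma (s b).
Proof.
move=> Hab hs [p prf]; exists (rcons p (s a)); apply/is_proof_rcons.
split=> //; right; exists ([:: a], b), s; split=> // chi.
by rewrite inE => /eqP->; rewrite mem_rcons mem_head.
Qed.

(** Checking the rules uninstantiated is enough: the value under [h] of an instance by [s] is the
    value of the rule under [h \o s], again a homomorphism. *)
Lemma derivable_sound (A : algebra) (F : set A) (h : Fm -> A) phi :
    (forall r (g : Fm -> A), H r -> is_hom g ->
      (forall chi, chi \in r.1 -> F (g chi)) -> F (g r.2)) ->
    is_hom h -> h @` Gamma `<=` F -> derivable H Gamma phi -> F (h phi).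
Proof.
move=> soundH hh GF [p prf].
(* All lines are treated at once, since a rule may use any earlier line. *)
suff Fp q : is_proof H Gamma q -> forall chi, chi \in q -> F (h chi).
  by apply: Fp prf _ _; rewrite mem_rcons mem_head.
elim/last_ind: q => // q psi IHq /is_proof_rcons[/IHq Fq step] chi.
rewrite mem_rcons inE => /predU1P[->|/Fq//].
case: step => [Gpsi|[r [s [Hr hs -> Fr]]]]; first by apply: GF; exists psi.
by apply: (soundH r (h \o s)) => // [|c /Fr/Fq//]; apply: is_hom_comp.
Qed.

End HilbertCalculus.

(** * Soundness of the rules and interderivability *)

(** Equality of the two values, rather than mere truth preservation, is what makes the rules sound
    for an arbitrary subset [F]. *)
Lemma calculus_CR_sound (A : comPzRingType) (g : Fm -> ring_algebra A) r :
  is_hom g -> r \in calculus_CR -> exists2 a, r.1 = [:: a] & g a = g r.2.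
Proof.
move=> [gD gM gN g0 g1]; rewrite !inE.
do !case/orP; move=> /eqP->; eexists=> //=; rewrite !(gD, gM, gN, g0, g1) /=;
  rewrite ?(mulrA, addrA, mulr1, addr0, mul1r, add0r, mulr0, mulrDr, opprD,
            mulrN, mulNr, addrK);
  (* After expansion only the commutativity rules (B) and (E) still differ on the two sides. *)
  first [by [] | by rewrite mulrAC | by rewrite addrAC].
Qed.

(** Ranging over all [Gamma] makes transitivity that of [<->], with no concatenation of proofs. *)
Definition interderivable a b :=
  forall Gamma, derivable [set` calculus_CR] Gamma a <->
                derivable [set` calculus_CR] Gamma b.

Lemma interderivable_sym a b : interderivable a b -> interderivable b a.
Proof. by move=> ab G; rewrite ab. Qed.

Lemma interderivable_trans b a c :
  interderivable a b -> interderivable b c -> interderivable a c.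
Proof. by move=> ab bc G; rewrite ab. Qed.

(* The rules number [2 * k] and [2 * k + 1] of the calculus are mutually
   inverse, so that [k] indexes the items (A), ..., (O). *)
Lemma interderivable_rule k (v : nat -> Fm) : (k < 13)%N ->
  let r := nth ([::], Zero) calculus_CR k.*2 in
  interderivable (eval v (head Zero r.1)) (eval v r.2).
Proof.
have hv : is_substitution (eval v) by apply: eval_is_hom.
by do 13?[case: k => [_ r G|k];
  first by split; apply: derivable_rule1 => //; rewrite /r /= !inE eqxx ?orbT].
Qed.

(** * Indiscernibility is a congruence *)

Definition indiscernible a b :=
  forall w u, interderivable (w + u * a)%Fm (w + u * b)%Fm.

(** The list follows the numbering of the variables in [calculus_CR]; letters absent from a rule are
    filled with [Zero]. *)
Local Ltac by_rule k x y z :=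
  let w := fresh "w" in let u := fresh "u" in move=> w u;
  exact: (@interderivable_rule k (nth Zero [:: x; y; z; u; w]) isT).

Local Open Scope fm_scope.

Lemma indiscernible_mulA x y z : indiscernible (x * y * z) (x * (y * z)).
Proof. by_rule 0%N x y z. Qed.

Lemma indiscernible_mulC x y : indiscernible (x * y) (y * x).
Proof. by_rule 1%N x y Zero. Qed.

Lemma indiscernible_mul1 x : indiscernible (x * 1) x.
Proof. by_rule 2%N x Zero Zero. Qed.

Lemma indiscernible_addA x y z : indiscernible (x + y + z) (x + (y + z)).
Proof. by_rule 3%N x y z. Qed.

Lemma indiscernible_addC x y : indiscernible (x + y) (y + x).
Proof. by_rule 4%N x y Zero. Qed.

Lemma indiscernible_add0 x : indiscernible (x + 0) x.
Proof. by_rule 5%N x Zero Zero. Qed.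

Lemma indiscernible_addN x : indiscernible (x + - x) 0.
Proof. by_rule 6%N x Zero Zero. Qed.

Lemma indiscernible_mulDr x y z : indiscernible (x * (y + z)) (x * y + x * z).
Proof. by_rule 7%N x y z. Qed.

Lemma indiscernible_mulNr x y : indiscernible (- (x * y)) (- x * y).
Proof. by_rule 9%N x y Zero. Qed.

Lemma indiscernible_mulrN x y : indiscernible (- (x * y)) (x * - y).
Proof. by_rule 10%N x y Zero. Qed.

Lemma interderivable_add0 x : interderivable (0 + x) x.
Proof. exact: (@interderivable_rule 11%N (fun=> x) isT). Qed.

Lemma interderivable_mul1 x y : interderivable (x + 1 * y) (x + y).
Proof. exact: (@interderivable_rule 12%N (nth Zero [:: x; y]) isT). Qed.

Lemma indiscernible_sym a b : indiscernible a b -> indiscernible b a.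
Proof. by move=> ab w u; apply: interderivable_sym. Qed.

Lemma indiscernible_trans b a c :
  indiscernible a b -> indiscernible b c -> indiscernible a c.
Proof. by move=> ab bc w u; apply: interderivable_trans (ab w u) (bc w u). Qed.

(** The case [u = 1], where rule (O) erases the factor. *)
Lemma indiscernible_addl w a b :
  indiscernible a b -> interderivable (w + a) (w + b).
Proof.
move=> /(_ w 1) ab; apply: interderivable_trans (interderivable_mul1 w b).
exact/(interderivable_trans _ ab)/interderivable_sym/interderivable_mul1.
Qed.

(** The case [w = 0], where rule (N) erases the summand. *)
Lemma indiscernible_interderivable a b :
  indiscernible a b -> interderivable a b.
Proof.
move=> /(indiscernible_addl 0) ab.
apply: interderivable_trans (interderivable_add0 b).
exact/(interderivable_trans _ ab)/interderivable_sym/interderivable_add0.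
Qed.

(* The context [w + u * (c * _)] is absorbed into [w + (u * c) * _]; the
   next two lemmas similarly use [(w + u * c) + u * _] and [w + (- u) * _]. *)
Lemma indiscernible_mul2l c a b :
  indiscernible a b -> indiscernible (c * a) (c * b).
Proof.
move=> ab w u; have E x : interderivable (w + u * (c * x)) (w + u * c * x).
  exact/indiscernible_addl/indiscernible_sym/indiscernible_mulA.
exact/(interderivable_trans (E a))/(interderivable_trans (ab _ _))
     /interderivable_sym.
Qed.

Lemma indiscernible_add2l c a b :
  indiscernible a b -> indiscernible (c + a) (c + b).
Proof.
move=> ab w u; have E x : interderivable (w + u * (c + x)) (w + u * c + u * x).
  apply: interderivable_trans (indiscernible_addl _ (indiscernible_mulDr _ _ _)) _.
  exact/indiscernible_interderivable/indiscernible_sym/indiscernible_addA.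
exact/(interderivable_trans (E a))/(interderivable_trans (ab _ _))
     /interderivable_sym.
Qed.

Lemma indiscernible_opp a b : indiscernible a b -> indiscernible (- a) (- b).
Proof.
move=> ab w u; have E x : interderivable (w + u * - x) (w + - u * x).
  apply/indiscernible_addl/indiscernible_trans/indiscernible_mulNr.
  exact/indiscernible_sym/indiscernible_mulrN.
exact/(interderivable_trans (E a))/(interderivable_trans (ab _ _))
     /interderivable_sym.
Qed.

(** Commutativity carries the one-sided congruence over to the other factor. *)
Lemma indiscernible_mul a b c d :
  indiscernible a b -> indiscernible c d -> indiscernible (a * c) (b * d).
Proof.
move=> ab cd; apply: indiscernible_trans (indiscernible_mul2l _ cd) _.
apply: indiscernible_trans (indiscernible_mulC _ _).
exact: indiscernible_trans (indiscernible_mulC _ _) (indiscernible_mul2l _ ab).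
Qed.

Lemma indiscernible_add a b c d :
  indiscernible a b -> indiscernible c d -> indiscernible (a + c) (b + d).
Proof.
move=> ab cd; apply: indiscernible_trans (indiscernible_add2l _ cd) _.
apply: indiscernible_trans (indiscernible_addC _ _).
exact: indiscernible_trans (indiscernible_addC _ _) (indiscernible_add2l _ ab).
Qed.

Local Close Scope fm_scope.

(** * The quotient ring *)

HB.instance Definition _ := gen_choiceMixin formula.

Definition indiscernibleb : rel formula := fun a b => `[< indiscernible a b >].

Lemma indiscernibleb_equiv : equiv_class_of indiscernibleb.
Proof.
split=> [a|a b|b a c].
- exact/asboolP.
- by apply/asboolP/asboolP; apply: indiscernible_sym.
- move=> /asboolP ab /asboolP bc; exact/asboolP/(indiscernible_trans ab).
Qed.

Canonical indiscernible_rel := EquivRelPack indiscernibleb_equiv.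

(** By soundness, indiscernible formulas agree in every commutative ring, so this is the ring of
    integer polynomials in countably many indeterminates. *)
Definition free_CR := {eq_quot indiscernible_rel}%qT.

HB.instance Definition _ := Choice.on free_CR.
HB.instance Definition _ := EqQuotient.on free_CR.

Definition class (a : formula) : free_CR := \pi_free_CR%qT a.

Lemma classP a b : class a = class b <-> indiscernible a b.
Proof. by split=> [/eqmodP/asboolP//|ab]; apply/eqmodP/asboolP. Qed.

Lemma reprE a : indiscernible (repr (class a)) a.
Proof. by apply/classP; rewrite /class reprK. Qed.

Definition free_add (p q : free_CR) := class (Add (repr p) (repr q)).
Definition free_mul (p q : free_CR) := class (Mul (repr p) (repr q)).
Definition free_opp (p : free_CR) := class (Opp (repr p)).

(** The congruence property makes the choice of representatives immaterial. *)
Lemma class_add a b : class (Add a b) = free_add (class a) (class b).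
Proof. by apply/esym/classP/indiscernible_add; apply: reprE. Qed.

Lemma class_mul a b : class (Mul a b) = free_mul (class a) (class b).
Proof. by apply/esym/classP/indiscernible_mul; apply: reprE. Qed.

Lemma class_opp a : class (Opp a) = free_opp (class a).
Proof. exact/esym/classP/indiscernible_opp/reprE. Qed.

(** Reduces ring axioms to classes of formulas; [class_morph] read backwards then leaves one
    indiscernibility to prove. *)
Lemma class_ind (P : free_CR -> Prop) : (forall a, P (class a)) -> forall p, P p.
Proof. by move=> Pcl p; rewrite -[p]reprK. Qed.

Definition class_morph := (class_add, class_mul, class_opp).

Lemma free_addA : associative free_add.
Proof.
elim/class_ind=> a; elim/class_ind=> b; elim/class_ind=> c.
by rewrite -!class_morph; apply/esym/classP/indiscernible_addA.
Qed.

Lemma free_addC : commutative free_add.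
Proof.
elim/class_ind=> a; elim/class_ind=> b.
by rewrite -!class_morph; apply/classP/indiscernible_addC.
Qed.

Lemma free_add0 : left_id (class Zero) free_add.
Proof.
elim/class_ind=> a; rewrite free_addC -!class_morph.
exact/classP/indiscernible_add0.
Qed.

Lemma free_addN : left_inverse (class Zero) free_opp free_add.
Proof.
elim/class_ind=> a; rewrite free_addC -!class_morph.
exact/classP/indiscernible_addN.
Qed.

Lemma free_mulA : associative free_mul.
Proof.
elim/class_ind=> a; elim/class_ind=> b; elim/class_ind=> c.
by rewrite -!class_morph; apply/esym/classP/indiscernible_mulA.
Qed.

Lemma free_mulC : commutative free_mul.
Proof.
elim/class_ind=> a; elim/class_ind=> b.
by rewrite -!class_morph; apply/classP/indiscernible_mulC.
Qed.

Lemma free_mul1 : left_id (class One) free_mul.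
Proof.
elim/class_ind=> a; rewrite free_mulC -!class_morph.
exact/classP/indiscernible_mul1.
Qed.

Lemma free_mulDl : left_distributive free_mul free_add.
Proof.
(* Rule (H) has the common factor on the left, so [r] is first moved to the front. *)
move=> p q r; rewrite !(free_mulC _ r); move: r p q.
elim/class_ind=> a; elim/class_ind=> b; elim/class_ind=> c.
by rewrite -!class_morph; apply/classP/indiscernible_mulDr.
Qed.

HB.instance Definition _ :=
  GRing.isZmodule.Build free_CR free_addA free_addC free_add0 free_addN.
HB.instance Definition _ := GRing.Zmodule_isComPzRing.Build free_CR
  free_mulA free_mulC free_mul1 free_mulDl.

Lemma class_is_hom : @is_hom Fm (ring_algebra free_CR) class.
Proof. split=> //; [exact: class_add | exact: class_mul | exact: class_opp]. Qed.

Theorem theorem4p6 (Gamma : set formula) (phi : formula) :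
  derivable [set` calculus_CR] Gamma phi <-> logic_CR Gamma phi.
Proof.
(* Here [subset_refl] instantiates the wildcard [F] with the image of [Gamma] under [class]. *)
split=> [prf A F h hh GF | /(_ free_CR _ class class_is_hom (@subset_refl _ _))].
  apply: derivable_sound hh GF prf => r g Hr hg.
  have [a -> <-] := calculus_CR_sound hg Hr.
  by apply; rewrite mem_head.
move=> [gamma Ggamma /classP/indiscernible_interderivable <-].
exact: derivable_hyp.
Qed.
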